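(* Let $n\ge1$ and let $I$ be a nonempty subset of $[n]$. Let $Q(\lambda)=\lambda\log\lambda-\lambda+1\ (\ge 0)$, with $Q(0)=1$. (1) For $0\le\lambda\le1$, \[ \mathbb{P}\big(C_I(\sigma)\le\lambda H(I)\big)\le 2e^{1-Q(\lambda)H(I)}. \] (2) For $\lambda\ge1$, \[ \mathbb{P}\big(C_I(\sigma)\ge\lambda H(I)+1\big)\le 2e^{1-Q(\lambda)H(I)}. \] (3) For $0\le\psi\le\sqrt{H(I)}$, \[ \mathbb{P}\left(|C_I(\sigma)-H(I)|\ge\psi\sqrt{H(I)}\right)\le 20e^{-\frac13\psi^2}. \]
   Context: $[n]=\{1,\ldots,n\}$. The probability $\mathbb{P}$ is with respect to a uniformly random permutation $\sigma$ in the symmetric group $\mathcal{S}_n$ on $[n]$. For $I\subseteq[n]$, $C_I(\sigma)$ is the number of cycles of $\sigma$ whose lengths lie in $I$ (fixed points count as cycles of length 1), and $H(I)=\sum_{j\in I}1/j$. Here $\lambda,\psi$ are real, and $0\log 0=0$. *)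

(* Defs.v *)
From HB Require Import structures.
From mathcomp Require Import all_boot all_order all_algebra all_fingroup.
From mathcomp Require Import reals sequences exp.

Set Implicit Arguments.
Unset Strict Implicit.
Unset Printing Implicit Defensive.

Import Order.TTheory GRing.Theory Num.Theory.

Local Open Scope ring_scope.

(* A subset I of [n] = {1, ..., n} is encoded as a set of ordinals             *)
(* I : {set 'I_n.+1} that does not contain ord0, so that the elements of I,    *)
(* coerced to nat, are the actual integers j with 1 <= j <= n.                 *)

(* The cycles of s : 'S_n are its orbits (the elements of porbits s),          *)
(* singletons included.                                                        *)
Definition cycle_count (n : nat) (I : {set 'I_n.+1}) (s : 'S_n) : nat :=
  #|[set c in porbits s | [exists j in I, #|c| == j]]|.

Definition harmonic_sum (R : realType) (n : nat) (I : {set 'I_n.+1}) : R :=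
  \sum_(j in I) (j%:R)^-1.

Definition perm_prob (R : realType) (n : nat) (A : pred 'S_n) : R :=
  #|[set s : 'S_n | A s]|%:R / #|[set: 'S_n]|%:R.

Definition Q (R : realType) (x : R) : R := x * ln x - x + 1.

Lemma Q0 (R : realType) : Q (0 : R) = 1.
Proof. by rewrite /Q mul0r subr0 add0r. Qed.

(* Main.v *)
Require Import Defs.
From mathcomp Require Import classical_sets topology normedtype derive.
From HB Require Import structures.
From mathcomp Require Import all_boot all_order all_algebra all_fingroup.
From mathcomp Require Import reals sequences exp.
From mathcomp Require Import ring lra.

Set Implicit Arguments.
Unset Strict Implicit.
Unset Printing Implicit Defensive.

Import Order.TTheory GRing.Theory Num.Theory.
Import numFieldNormedType.Exports.

Local Open Scope ring_scope.

(** Exponential moments give all the tails. Fix z >= 0, let C be the number of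
cycles of a uniform permutation of n points whose length lies in I, and let H
be the sum of 1/j over I. The key estimate ([mgf_le]) is

    E z^C <= max(1, z) exp(1 + (z - 1) H).

Markov's inequality at z = lambda then makes the exponent 1 - Q(lambda) H: the
loss exp(- lambda H ln lambda) and the factor exp((lambda - 1) H) combine to
exp(- Q(lambda) H). For lambda > 1 there is an extra factor lambda, which the
shift by one in the event C >= lambda H + 1 cancels exactly. The central
estimate takes lambda = 1 - psi / sqrt H and lambda = 1 + psi / sqrt H, where
Q(lambda) >= (lambda - 1)^2 / 3 because lambda lies in [0, 2].

For the moment bound, give a cycle of length l the weight w(l) = z if l is in I
and 1 otherwise, so that E z^C = a_n, the normalised sum over all permutations
of the products of cycle weights. Peeling off the cycle through one point shows

    m a_m <= w(1) a_(m-1) + w(2) a_(m-2) + ... + w(m) a_0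

([perm_weight_sum_peel], [cycle_coef_rec]): as only upper bounds are wanted, it
is enough that a permutation is determined by that cycle and its action on the
remaining points. The recursion gives two things. First,
n a_n <= max(1, z) (a_0 + ... + a_(n-1)), as every weight is at most max(1, z).
Second, the polynomials p = sum a_m X^m and q = sum (w(j) / j) X^j satisfy
p' <= q' p coefficientwise, so p exp(- q) decreases on [0, 1] and
a_0 + ... + a_(n-1) <= exp(q(1)) ([sum_le_exp]). Finally
q(1) = (1 + 1/2 + ... + 1/n) + (z - 1) H, and the harmonic number is at most
1 + ln n, which absorbs the division by n. *)

(** * Peeling one cycle off a permutation *)

(** The image of A under [porbit s], rather than a set of subsets of A, lists
the cycles that meet A; for [s] supported in A these are the cycles inside A,
with the fixed points of [s] in A and without those outside. *)
Definition orbit_weight (R : pzSemiRingType) (T : finType) (w : nat -> R)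
    (A : {set T}) (s : {perm T}) : R :=
  \prod_(c in porbit s @: A) w #|c|.

Definition perm_weight_sum (R : pzSemiRingType) (T : finType) (w : nat -> R)
    (A : {set T}) : R :=
  \sum_(s : {perm T} | perm_on A s) orbit_weight w A s.

(** A sequence rather than a set keeps the cyclic order, so that [t] determines
s on the orbit of x, and the possible [t] are counted by a falling factorial. *)
Definition first_orbit (T : finType) (x : T) (t : seq T) (s : {perm T}) :=
  (t == traject s (s x) (size t)) && (#|porbit s x| == (size t).+1).

Lemma first_orbitE (T : finType) (x : T) t (s : {perm T}) :
  first_orbit x t s -> porbit s x = [set y in x :: t].
Proof.
move=> /andP[/eqP tE /eqP c]; apply/setP => y.
by rewrite porbit_traject c trajectS -tE inE.
Qed.

Lemma porbit_sub (T : finType) (A : {set T}) (s : {perm T}) x :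
  perm_on A s -> x \in A -> porbit s x \subset A.
Proof.
move=> sA xA; apply/subsetP => y /porbitP[i ->].
elim: i => [|i IH]; first by rewrite expg0 perm1.
by rewrite expgSr permM perm_closed.
Qed.

Lemma eq_porbit_in (T : finType) (s s' : {perm T}) (x : T) :
  {in porbit s x, s' =1 s} -> porbit s' x = porbit s x.
Proof.
move=> e.
have it i : (s' ^+ i)%g x = (s ^+ i)%g x.
  elim: i => [|i IH]; first by rewrite !expg0.
  by rewrite !expgSr !permM IH e // mem_porbit.
by apply/setP => y; apply/porbitP/porbitP => -[i ->]; exists i; rewrite it.
Qed.

Section PeelOrbit.
Variables (T : finType) (A : {set T}) (x : T).

Let rest t : {set T} := A :\: [set y in x :: t].

Lemma rest_stable t (s : {perm T}) :
  perm_on A s -> first_orbit x t s -> s \in ('N(rest t | 'P))%g.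
Proof.
move=> sA st; apply/astabsP => y /=.
rewrite /rest -(first_orbitE st) !in_setD apermE.
by rewrite -!eq_porbit_mem -(porbit_perm s 1 y) expg1 (perm_closed y sA).
Qed.

(** A permutation is determined by its cycle through x, spelled out by [t], and
its action on the remaining points. *)
Lemma restr_rest_inj t :
  {in [set s | perm_on A s & first_orbit x t s] &,
     injective (restr_perm (rest t))}.
Proof.
move=> s s'; rewrite !inE => /andP[sA st] /andP[s'A s't] e.
apply/permP => y.
have [yA|yA] := boolP (y \in A); last by rewrite !(out_perm _ yA).
have [yC|yC] := boolP (y \in [set y in x :: t]); last first.
  have yr : y \in rest t by rewrite /rest in_setD yC.
  by rewrite -(restr_permE (rest_stable sA st) yr) e restr_permE // rest_stable.
have [/andP[/eqP tE /eqP c] /andP[/eqP t'E /eqP c']] := (st, s't).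
(* The end case i = (size t).+1 closes both cycles at x. *)
have it i : (i <= (size t).+1)%N -> iter i s x = iter i s' x.
  rewrite leq_eqVlt => /predU1P[->|]; first by rewrite -{1}c -c' !iter_porbit.
  case: i => [//|i]; rewrite ltnS => ilt.
  rewrite !iterSr -(nth_traject s ilt) -(nth_traject s' ilt) -tE -t'E.
  exact: set_nth_default.
move: yC; rewrite -(first_orbitE st) porbit_traject c => /trajectP[i ilt ->].
by rewrite -iterS it // iterS [in RHS]it // ltnW.
Qed.

Lemma orbit_weight_peel (R : comPzSemiRingType) (w : nat -> R) t
    (s : {perm T}) :
  x \in A -> perm_on A s -> first_orbit x t s ->
  orbit_weight w A s =
    w (size t).+1 * orbit_weight w (rest t) (restr_perm (rest t) s).
Proof.
move=> xA sA st; have [_ /eqP c] := andP st.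
have CE := first_orbitE st.
have imE : porbit s @: A = porbit s x |: (porbit s @: rest t).
  rewrite -imsetU1; apply/setP => D; apply/imsetP/imsetP => -[y yA ->].
    have [yC|yC] := boolP (y \in porbit s x).
      by exists x; rewrite ?setU11 //; apply/eqP; rewrite eq_porbit_mem.
    by exists y => //; rewrite in_setU1 in_setD yA -CE yC orbT.
  by exists y => //; case/setU1P: yA => [->//|/setDP[]].
rewrite /orbit_weight imE big_setU1 /=; last first.
  apply/imsetP => -[y /setDP[_ yC] e]; case/negP: yC.
  by rewrite -CE e porbit_id.
have sN := rest_stable sA st.
suff -> : porbit s @: rest t = porbit (restr_perm (rest t) s) @: rest t.
  by rewrite c.
apply: eq_in_imset => y yr; apply/esym/eq_porbit_in => z zy.
apply: restr_permE => //.
by case/porbitP: zy => i ->; rewrite -apermE (astabsP (groupX i sN)).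
Qed.

End PeelOrbit.

Lemma sum_inj_le (R : numDomainType) (I J : finType) (P : {set I}) (Q : pred J)
    (f : I -> J) (g : J -> R) :
  {in P &, injective f} -> (forall i, i \in P -> Q (f i)) ->
  (forall j, Q j -> 0 <= g j) ->
  \sum_(i in P) g (f i) <= \sum_(j | Q j) g j.
Proof.
move=> fI fQ g0; rewrite -big_imset //= big_mkcond [leRHS]big_mkcond /=.
apply: ler_sum => j _; case: ifP => [/imsetP[i iP ->]|_]; first by rewrite fQ.
by case: ifP => // /g0.
Qed.

Section CycleRecursion.
Variables (R : realFieldType) (T : finType) (w : nat -> R).
Hypothesis w_ge0 : forall j, 0 <= w j.

Lemma orbit_weight_ge0 (A : {set T}) s : 0 <= orbit_weight w A s.
Proof. exact: prodr_ge0. Qed.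

(** Classify the permutations of A by their cycle [x :: t] through x: the cycle
contributes its weight, and the rest of the permutation injects into the
permutations of the points left over. *)
Lemma perm_weight_sum_peel (A : {set T}) x : x \in A ->
  perm_weight_sum w A <=
    \sum_(j < #|A|) \sum_(t : j.-tuple T | all (mem (A :\ x)) t && uniq t)
       w j.+1 * perm_weight_sum w (A :\: [set y in x :: t]).
Proof.
move=> xA.
pose h t s := orbit_weight w (A :\: [set y in x :: t])
  (restr_perm (A :\: [set y in x :: t]) s).
(* For each s exactly one pair (j, t) spells out the orbit of x, so inserting
   the double sum costs nothing. *)
apply: (@le_trans _ _ (\sum_(s | perm_on A s) \sum_(j < #|A|)
    \sum_(t : j.-tuple T | all (mem (A :\ x)) t && uniq t)
    (if first_orbit x t s then w j.+1 * h t s else 0))).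
  apply: ler_sum => s sA.
  have CA := porbit_sub sA xA.
  have := card_porbit_neq0 s x; case c : #|porbit s x| => [//|j] _.
  have jA : (j < #|A|)%N by rewrite -c subset_leq_card.
  have tP : size (traject s (s x) j) == j by rewrite size_traject.
  pose t := Tuple tP.
  have st : first_orbit x t s by rewrite /first_orbit /= size_traject c !eqxx.
  have pos k (u : k.-tuple T) :
      0 <= (if first_orbit x u s then w k.+1 * h u s else 0).
    case: ifP => // _; rewrite mulr_ge0 //; exact: orbit_weight_ge0.
  rewrite (bigD1 (Ordinal jA)) //= (bigD1 t) /=; last first.
    have /= := uniq_traject_porbit s x; rewrite c /= => /andP[xt ->].
    rewrite andbT; apply/allP => y yt /=; rewrite !inE.
    apply/andP; split; first by apply: contraNneq xt => yx; rewrite -{1}yx.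
    apply: (subsetP CA); rewrite porbit_traject c trajectS inE.
    by rewrite [X in _ || X]yt orbT.
  rewrite st (orbit_weight_peel w xA sA st) size_tuple -addrA lerDl.
  by apply: addr_ge0; do ?[apply: sumr_ge0 => ? _ | exact: pos].
rewrite exchange_big /=; apply: ler_sum => j _.
rewrite exchange_big /=; apply: ler_sum => t _.
rewrite -big_mkcondr /= -mulr_sumr ler_wpM2l //.
rewrite /h (eq_bigl (mem [set s | perm_on A s & first_orbit x t s]));
  last by move=> s; rewrite !inE.
apply: (sum_inj_le (restr_rest_inj (t := t))) => s _.
  exact: restr_perm_on.
exact: orbit_weight_ge0.
Qed.

(** The coefficient a_m. The normalised weight sum depends only on the cardinal
of A, so the maximum is over equal values; taking it spares transporting
permutations between sets of the same size. *)
Definition cycle_coef (m : nat) : R :=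
  \big[Order.max/0]_(A : {set T} | #|A| == m) (perm_weight_sum w A / m`!%:R).

Lemma cycle_coef_ge0 m : 0 <= cycle_coef m.
Proof. exact: bigmax_ge_id. Qed.

Lemma perm_weight_sum_le (A : {set T}) :
  perm_weight_sum w A <= (#|A|)`!%:R * cycle_coef #|A|.
Proof.
rewrite mulrC -ler_pdivrMr ?ltr0n ?fact_gt0 //.
exact: (le_bigmax_cond _ _ (eqxx #|A|)).
Qed.

Lemma cycle_coef0 : cycle_coef 0 <= 1.
Proof.
apply/bigmax_leP; split=> // A; rewrite cards_eq0 => /eqP ->.
rewrite fact0 divr1 /perm_weight_sum (big_pred1 1%g) => [|s]; last first.
  apply/idP/eqP => [s0|->]; last exact: perm_on1.
  by apply/permP => y; rewrite perm1 (out_perm s0) // inE.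
by rewrite /orbit_weight imset0 big_set0.
Qed.

(** In a set of m + 1 points there are m (m-1) ... (m-j+1) ways to continue the
cycle of a given point by j further points, and this falling factorial times
(m - j)! is m!, so every cycle length gets the same coefficient. *)
Lemma cycle_coef_rec m :
  m.+1%:R * cycle_coef m.+1 <= \sum_(j < m.+1) w j.+1 * cycle_coef (m - j).
Proof.
rewrite mulrC -ler_pdivlMr ?ltr0n //; apply/bigmax_leP; split.
  by rewrite divr_ge0 // sumr_ge0 // => j _; rewrite mulr_ge0 // cycle_coef_ge0.
move=> A /eqP cA.
have /card_gt0P[x xA] : (0 < #|A|)%N by rewrite cA.
rewrite factS natrM invfM mulrA mulrAC ler_pM2r ?invr_gt0 ?ltr0n //.
rewrite ler_pdivrMr ?ltr0n ?fact_gt0 //.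
apply: le_trans (perm_weight_sum_peel xA) _; rewrite cA mulr_suml.
apply: ler_sum => j _.
have cAx : #|A :\ x| = m by move: (cardsD1 x A); rewrite xA cA => -[].
apply: (@le_trans _ _ (\sum_(t : j.-tuple T | all (mem (A :\ x)) t && uniq t)
    w j.+1 * ((m - j)`!%:R * cycle_coef (m - j)))).
  apply: ler_sum => t /andP[/allP tA ut]; apply: ler_wpM2l => //.
  suff -> : (m - j)%N = #|A :\: [set y in x :: t]| by exact: perm_weight_sum_le.
  rewrite cardsDS; last first.
    apply/subsetP => y; rewrite !inE => /predU1P[->//|/tA].
    by rewrite /= !inE => /andP[].
  rewrite cA cardsE (card_uniqP _) /= ?size_tuple ?subSS // ut andbT.
  by apply/negP => /tA; rewrite /= !inE eqxx.
rewrite sumr_const.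
have -> :
    #|(fun t : j.-tuple T => all (mem (A :\ x)) t && uniq t)| = (m ^_ j)%N.
  transitivity (#|A :\ x| ^_ j)%N; last by rewrite cAx.
  by rewrite -card_uniq_tuples; apply: eq_card => t; rewrite !inE.
have jm : (j <= m)%N by rewrite -ltnS.
rewrite -mulr_natr -(ffact_fact jm) natrM le_eqVlt; apply/orP; left; apply/eqP.
ring.
Qed.

End CycleRecursion.

(** * From the recursion to an exponential bound *)

Lemma le_horner (R : numDomainType) (p q : {poly R}) (x : R) :
  (forall i, p`_i <= q`_i) -> 0 <= x -> p.[x] <= q.[x].
Proof.
move=> pq x0; rewrite -subr_ge0 -hornerN -hornerD horner_coef.
by apply: sumr_ge0 => i _; rewrite mulr_ge0 ?exprn_ge0 // coefB subr_ge0.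
Qed.

(** Gronwall's argument: the derivative of p exp(- q) is (p' - q' p) exp(- q),
which is nonpositive on [0, 1]. *)
Lemma expR_poly_bound (R : realType) (p q : {poly R}) :
  (forall i, p^`()`_i <= (q^`() * p)`_i) ->
  p.[1] * expR (- q.[1]) <= p.[0] * expR (- q.[0]).
Proof.
move=> le_pq; pose f (x : R) := p.[x] * expR (- q.[x]).
have df (x : R) : is_derive x (1 : R) f
    ((p^`().[x] - q^`().[x] * p.[x]) * expR (- q.[x])).
  rewrite /f; apply: trigger_derive.
  rewrite /GRing.scale /=; ring.
apply: (@ler0_derive1_le_cc R f 0 1) => //; rewrite ?in_itv /= ?lexx ?ler01 //.
- move=> x; rewrite in_itv /= => /andP[/ltW x0 _]; rewrite derive1E derive_val.
  by rewrite pmulr_lle0 ?expR_gt0 // subr_le0 -hornerM; exact: le_horner.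
- apply: continuous_subspaceT => x; apply/differentiable_continuous.
  exact/derivable1_diffP.
Qed.

(** The recursion is the coefficientwise form of p' <= q' p, where p and q have
coefficients a_m and w_j / j. *)
Lemma sum_le_exp (R : realType) (a w : nat -> R) n :
  a 0%N <= 1 -> (forall m, 0 <= a m) -> (forall j, 0 <= w j) ->
  (forall m, m.+1%:R * a m.+1 <= \sum_(j < m.+1) w j.+1 * a (m - j)%N) ->
  \sum_(m < n) a m <= expR (\sum_(j < n) w j.+1 / j.+1%:R).
Proof.
move=> a0 a_ge0 w_ge0 a_rec; pose p := \poly_(m < n) a m.
pose q := \poly_(j < n.+1) (if j is 0 then 0 else w j / j%:R).
have p1 : p.[1] = \sum_(m < n) a m.
  by rewrite horner_poly; apply: eq_bigr => m _; rewrite expr1n mulr1.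
have q1 : q.[1] = \sum_(j < n) w j.+1 / j.+1%:R.
  rewrite horner_poly big_ord_recl mul0r add0r.
  by apply: eq_bigr => j _; rewrite expr1n mulr1.
have q0 : q.[0] = 0 by rewrite horner_coef0 coef_poly.
have p0 : p.[0] <= 1.
  by rewrite horner_coef0 coef_poly; case: ifP => _ //; exact: ler01.
have dq i : (q^`())`_i = if (i < n)%N then w i.+1 else 0.
  rewrite coef_deriv coef_poly ltnS; case: ifP => _; last by rewrite mul0rn.
  by rewrite /= -[LHS]mulr_natr divfK ?pnatr_eq0.
have := @expR_poly_bound R p q; rewrite p1 q1 q0 oppr0 expR0 mulr1 expRN.
rewrite ler_pdivrMr ?expR_gt0 // => le_pq.
apply: le_trans (le_pq _) _; last first.
  by rewrite -[leRHS]mul1r ler_wpM2r ?expR_ge0.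
move=> i; rewrite coef_deriv coefM coef_poly; case: ifP => [ltin|_]; last first.
  (* Above the truncation degree p' vanishes and q' p is nonnegative. *)
  rewrite mul0rn; apply: sumr_ge0 => j _; rewrite dq coef_poly mulr_ge0 //.
    by case: ifP.
  by case: ifP.
rewrite -mulr_natl; apply: le_trans (a_rec i) _; apply: ler_sum => j _.
have ji : (j <= i)%N by rewrite -ltnS.
rewrite dq coef_poly (leq_ltn_trans ji (ltnW ltin)) //.
by rewrite (leq_ltn_trans (leq_subr _ _) (ltnW ltin)).
Qed.

(** * Logarithmic inequalities *)

Lemma harmonic_le_ln (R : realType) (n : nat) :
  \sum_(j < n.+1) (j.+1%:R : R)^-1 <= 1 + ln n.+1%:R.
Proof.
elim: n => [|n IH]; first by rewrite big_ord1 ln1 addr0 invr1.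
rewrite big_ord_recr /=; apply: le_trans (lerD IH (lexx _)) _.
have n0 : 0 < n.+1%:R :> R by rewrite ltr0n.
have n1 : 0 < n.+2%:R :> R by rewrite ltr0n.
(* ln (n + 1) = ln (n + 2) + ln (1 - 1 / (n + 2)), and ln (1 - u) <= - u. *)
have -> : n.+1%:R = n.+2%:R * (1 - n.+2%:R^-1) :> R.
  by rewrite mulrBr mulr1 divff ?gt_eqF // [in RHS]mulrS; ring.
have i1 : n.+2%:R^-1 < 1 :> R by rewrite invf_lt1 // ltr1n.
rewrite lnM ?posrE ?subr_gt0 //.
have := @le_ln1Dx R (- n.+2%:R^-1); rewrite ltrN2 => /(_ i1) h.
by rewrite -!addrA !lerD2l gerDl -lerBrDr sub0r.
Qed.

(** The difference of the two sides vanishes at 1 and has derivative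
(x - 1) (2 - x) / (3 x^2), which changes sign only at 1 on ]0, 2]. The bound is
what [(x - 1) ^+ 2 / 3 <= Q x] becomes after division by x. *)
Lemma ln_ge_rational (R : realType) (x : R) : 0 < x -> x <= 2 ->
  (x + 1 - 2 / x) / 3 <= ln x.
Proof.
pose f (x : R) := ln x - (x + 1 - 2 * x^-1) / 3.
have df (y : R) : 0 < y ->
    is_derive y (1 : R) f ((y - 1) * (2 - y) / (3 * y ^+ 2)).
  move=> y0; have yn0 : y != 0 by rewrite gt_eqF.
  have := is_derive1_ln y0 => Dln.
  have DV : is_derive y (1 : R) (fun z : R => z^-1) (- y ^- 2).
    apply: DeriveDef; first exact: derivableV.
    by rewrite deriveV // derive_id /GRing.scale /= mulr1.
  rewrite /f; apply: trigger_derive.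
  rewrite /GRing.scale /=; field.
  by [].
have cf a b : 0 < a -> {within `[a, b], continuous f}%classic.
  move=> a0; apply: derivable_within_continuous => y.
  rewrite in_itv /= => /andP[/(lt_le_trans a0) y0 _].
  by have := df _ y0; case.
have f1 : f 1 = 0 by rewrite /f ln1 invr1; field.
move=> x0 x2; rewrite -subr_ge0 -[leRHS]/(f x) -f1.
have [x1|x1] := leP x 1.
  apply: (@ler0_derive1_le_cc R f x 1) => //; rewrite ?in_itv /= ?lexx ?x1 //.
  - move=> y; rewrite in_itv /= => /andP[/(lt_trans x0) y0 _].
    by have := df _ y0; case.
  - move=> y; rewrite in_itv /= => /andP[/(lt_trans x0) y0 y1].
    have D := df _ y0; rewrite derive1E derive_val.
    rewrite pmulr_lle0 ?invr_gt0 ?mulr_gt0 ?exprn_gt0 //.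
    rewrite nmulr_rle0 ?subr_lt0 //; lra.
  - exact: cf.
apply: (@ger0_derive1_le_cc R f 1 x) => //;
  rewrite ?in_itv /= ?lexx ?(ltW x1) //.
- move=> y; rewrite in_itv /= => /andP[/(lt_trans ltr01) y0 _].
  by have := df _ y0; case.
- move=> y; rewrite in_itv /= => /andP[y1 yx].
  have y0 : 0 < y by apply: lt_trans y1.
  have D := df _ y0; rewrite derive1E derive_val.
  rewrite divr_ge0 // ?mulr_ge0 ?exprn_ge0 //; lra.
- exact: cf.
Qed.

(** This is ln (1 / x) <= 1 / x - 1, multiplied by x. *)
Lemma Q_ge0 (R : realType) (x : R) : 0 <= x -> 0 <= Q x.
Proof.
rewrite le_eqVlt => /predU1P[<-|x0]; first by rewrite Q0 ler01.
have i0 : 0 < x^-1 by rewrite invr_gt0.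
have := @le_ln1Dx R (x^-1 - 1); rewrite ltrBDr addNr addrC subrK lnV ?posrE //.
move=> /(_ i0); rewrite lerNl => h.
have := ler_wpM2l (ltW x0) h; rewrite mulrN mulrBr divff ?gt_eqF // /Q; lra.
Qed.

Lemma Q_ge_quadratic (R : realType) (x : R) : 0 <= x -> x <= 2 ->
  (x - 1) ^+ 2 / 3 <= Q x.
Proof.
rewrite le_eqVlt => /predU1P[<- _|x0 x2]; first by rewrite Q0; lra.
have := ler_wpM2l (ltW x0) (ln_ge_rational x0 x2).
have -> : x * ((x + 1 - 2 / x) / 3) = (x ^+ 2 + x - 2) / 3.
  by field; rewrite gt_eqF.
rewrite /Q; lra.
Qed.

(** Since exp(- 1 / 2) >= 1 / 2. *)
Lemma expR1_le4 (R : realType) : expR (1 : R) <= 4.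
Proof.
have h : 1 / 2 <= expR (- (1 / 2) : R).
  by apply: le_trans (expR_ge1Dx _); lra.
have e : expR (1 : R) * (expR (- (1 / 2)) * expR (- (1 / 2))) = 1.
  rewrite -!expRD -[RHS]expR0; congr expR; lra.
have h2 : 1 / 2 * (1 / 2) <= expR (- (1 / 2) : R) * expR (- (1 / 2)).
  by apply: ler_pM => //; lra.
have := ler_wpM2l (expR_ge0 (1 : R)) h2; rewrite e; lra.
Qed.

(** * The exponential moment of the cycle count *)

Definition mark_weight (R : realType) n (I : {set 'I_n}) (z : R)
    (l : nat) : R :=
  if [exists j in I, l == j] then z else 1.

Lemma mark_weightE (R : realType) n (I : {set 'I_n}) (z : R) (i : 'I_n) :
  mark_weight I z i = if i \in I then z else 1.
Proof.
rewrite /mark_weight; congr (if _ then _ else _).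
apply/existsP/idP => [[j /andP[jI /eqP/val_inj ->]]//|iI].
by exists i; rewrite iI eqxx.
Qed.

Lemma mark_weight_ge0 (R : realType) n (I : {set 'I_n}) (z : R) l :
  0 <= z -> 0 <= mark_weight I z l.
Proof. by rewrite /mark_weight; case: ifP. Qed.

Lemma cycle_count_weight (R : realType) n (I : {set 'I_n.+1}) (z : R)
    (s : 'S_n) :
  z ^+ cycle_count I s = orbit_weight (mark_weight I z) [set: 'I_n] s.
Proof.
rewrite /orbit_weight /mark_weight -big_mkcondr /= prodr_const; congr (_ ^+ _).
apply: eq_card => c; rewrite inE; congr (_ && _).
by apply/imsetP/imsetP => -[y _ ->]; exists y; rewrite ?inE.
Qed.

Lemma sum_mark_weight (R : realType) n (I : {set 'I_n.+1}) (z : R) :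
  ord0 \notin I ->
  \sum_(j < n) mark_weight I z j.+1 / j.+1%:R =
    \sum_(j < n) (j.+1%:R)^-1 + (z - 1) * harmonic_sum R I.
Proof.
move=> I0.
have -> : harmonic_sum R I =
    \sum_(j < n) (if lift ord0 j \in I then (j.+1%:R)^-1 else 0).
  by rewrite /harmonic_sum big_mkcond big_ord_recl (negPf I0) /= add0r.
rewrite mulr_sumr -big_split /=; apply: eq_bigr => j _.
rewrite -(lift0 j) mark_weightE; case: ifP => _; ring.
Qed.

(** The recursion at n + 1 bounds (n + 1) a_(n+1) by max(1, z) times the sum of
all earlier coefficients, and dividing by n + 1 turns the harmonic number in
the exponential bound of that sum into the constant 1. *)
Lemma mgf_le (R : realType) n (I : {set 'I_n.+2}) (z : R) :
  ord0 \notin I -> 0 <= z ->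
  (\sum_(s : 'S_n.+1) z ^+ cycle_count I s) / (n.+1)`!%:R
    <= Num.max 1 z * expR (1 + (z - 1) * harmonic_sum R I).
Proof.
move=> I0 z0; pose w := mark_weight I z; pose a := cycle_coef 'I_n.+1 w.
have w_ge0 l : 0 <= w l by exact: mark_weight_ge0.
have a_rec := @cycle_coef_rec _ 'I_n.+1 _ w_ge0.
have le_a : (\sum_(s : 'S_n.+1) z ^+ cycle_count I s) / (n.+1)`!%:R <= a n.+1.
  rewrite ler_pdivrMr ?ltr0n ?fact_gt0 // mulrC.
  have := perm_weight_sum_le w [set: 'I_n.+1]; rewrite cardsT card_ord.
  apply: le_trans; rewrite le_eqVlt; apply/orP; left; apply/eqP.
  rewrite /perm_weight_sum.
  apply: eq_big => s; last by rewrite cycle_count_weight.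
  by apply/esym/subsetP => y _; rewrite inE.
apply: le_trans le_a _.
have n0 : 0 < n.+1%:R :> R by rewrite ltr0n.
rewrite -(ler_pM2l n0); apply: le_trans (a_rec n) _.
have w_le l : w l <= Num.max 1 z.
  by rewrite /w /mark_weight le_max; case: ifP; rewrite lexx ?orbT.
have a_ge0 m : 0 <= a m by exact: cycle_coef_ge0.
have sum_le : \sum_(j < n.+1) w j.+1 * a (n - j)%N <=
    Num.max 1 z * \sum_(m < n.+1) a m.
  rewrite (reindex_inj rev_ord_inj) mulr_sumr; apply: ler_sum => j _ /=.
  have jn : (j <= n)%N by rewrite -ltnS.
  by rewrite subSS subKn //; apply: ler_wpM2r.
apply: le_trans sum_le _; rewrite mulrCA ler_wpM2l ?le_max ?ler01 //.
apply: le_trans (sum_le_exp n.+1 (cycle_coef0 _ _) a_ge0 w_ge0 a_rec) _.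
have nE : expR (ln n.+1%:R) = n.+1%:R :> R by rewrite lnK ?posrE.
rewrite sum_mark_weight // -nE -expRD ler_expR addrA lerD2r addrC.
exact: harmonic_le_ln.
Qed.

(** * Tail bounds *)

Lemma perm_prob_le_add (R : realType) n (A B C : pred 'S_n) :
  (forall s, A s -> B s || C s) ->
  perm_prob R A <= perm_prob R B + perm_prob R C.
Proof.
move=> sub; rewrite /perm_prob -mulrDl ler_wpM2r ?invr_ge0 //.
rewrite -natrD ler_nat; apply: leq_trans (leq_card_setU _ _).
by apply: subset_leq_card; apply/subsetP => s; rewrite !inE => /sub.
Qed.

(** Markov's inequality for x^C, with x both the base and the ratio to the mean.
The free constant K serves the upper tail, where a shift of the threshold by d
saves a factor x^d, to be set against max(1, x). *)
Lemma chernoff (R : realType) n (I : {set 'I_n.+2}) (A : pred 'S_n.+1)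
    (K x : R) :
  ord0 \notin I -> 0 <= K -> 0 <= x ->
  (forall s, A s -> 1 <= K * expR (- (x * ln x * harmonic_sum R I))
                           * x ^+ cycle_count I s) ->
  perm_prob R A <= K * (Num.max 1 x * expR (1 - Q x * harmonic_sum R I)).
Proof.
set H := harmonic_sum R I => I0 K0 x0 le_A.
have -> : 1 - Q x * H = - (x * ln x * H) + (1 + (x - 1) * H).
  by rewrite /Q; ring.
rewrite expRD (mulrCA (Num.max _ _)) [leRHS]mulrA.
have K'0 : 0 <= K * expR (- (x * ln x * H)) by rewrite mulr_ge0 ?expR_ge0.
apply: le_trans (ler_wpM2l K'0 (mgf_le I0 x0)).
rewrite /perm_prob cardsT card_Sn mulrA ler_wpM2r ?invr_ge0 //.
rewrite -sum1_card natr_sum mulr_sumr big_mkcond /=; apply: ler_sum => s _.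
by rewrite inE; case: ifP => [/le_A//|_]; rewrite mulr_ge0 ?exprn_ge0.
Qed.

Lemma exprn_expR (R : realType) (x : R) k :
  0 < x -> x ^+ k = expR (k%:R * ln x).
Proof. by move=> x0; rewrite expRM_natl lnK ?posrE. Qed.

Lemma lower_tail (R : realType) n (I : {set 'I_n.+2}) (x : R) :
  ord0 \notin I -> 0 <= x -> x <= 1 ->
  perm_prob R (fun s => (cycle_count I s)%:R <= x * harmonic_sum R I)
    <= expR (1 - Q x * harmonic_sum R I).
Proof.
set H := harmonic_sum R I => I0 x0 x1.
have := @chernoff R n I (fun s => (cycle_count I s)%:R <= x * H)
  1 x I0 ler01 x0.
rewrite max_l // !mul1r; apply => s.
move: x0; rewrite le_eqVlt => /predU1P[<-|x0].
  (* For x = 0 the event is C = 0, where 0 ^+ C = 1. *)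
  by rewrite !mul0r oppr0 expR0 lern0 => /eqP ->; rewrite expr0 mulr1.
move=> Cle; rewrite exprn_expR // -expRD -[leLHS]expR0 ler_expR.
by rewrite addrC subr_ge0 mulrAC; have := ler_wnM2r (ln_le0 x1) Cle.
Qed.

(** The shift d gains x^(-d) on the factor x lost in the exponential moment:
d = 1 cancels it, and d = 0 is the form the central estimate needs. *)
Lemma upper_tail (R : realType) n (I : {set 'I_n.+2}) (d x : R) :
  ord0 \notin I -> 1 <= x ->
  perm_prob R (fun s => x * harmonic_sum R I + d <= (cycle_count I s)%:R)
    <= expR (- (d * ln x)) * (x * expR (1 - Q x * harmonic_sum R I)).
Proof.
set H := harmonic_sum R I => I0 x1; have x0 := lt_le_trans ltr01 x1.
have := @chernoff R n I (fun s => x * H + d <= (cycle_count I s)%:R)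
  (expR (- (d * ln x))) x I0 (expR_ge0 _) (ltW x0).
rewrite max_r //; apply => s.
move=> Cge; rewrite exprn_expR // -!expRD -[leLHS]expR0 ler_expR.
rewrite addrC -opprD subr_ge0 [x * _ * _]mulrAC -mulrDl addrC.
by have := ler_wpM2r (ln_ge0 x1) Cge.
Qed.

Lemma harmonic_sum_gt0 (R : realType) n (I : {set 'I_n.+1}) :
  ord0 \notin I -> I != set0 -> 0 < harmonic_sum R I.
Proof.
move=> I0 /set0Pn[i iI]; rewrite /harmonic_sum (bigD1 i) //=.
apply: ltr_pwDl; last by apply: sumr_ge0 => j _; rewrite invr_ge0.
rewrite invr_gt0 ltr0n lt0n.
by apply: contraNneq I0 => i0; rewrite (_ : ord0 = i) //; exact: val_inj.
Qed.

(** Each tail has e <= 4 in front of the Gaussian factor, and the upper one also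
the ratio 1 + psi / sqrt H <= 2: in total 4 + 2 * 4 = 12. *)
Lemma central_tail (R : realType) n (I : {set 'I_n.+2}) (psi : R) :
  ord0 \notin I -> I != set0 ->
  0 <= psi -> psi <= Num.sqrt (harmonic_sum R I) ->
  perm_prob R (fun s => psi * Num.sqrt (harmonic_sum R I)
                          <= `|(cycle_count I s)%:R - harmonic_sum R I|)
    <= 12 * expR (- (1 / 3) * psi ^+ 2).
Proof.
set H := harmonic_sum R I => I0 In0 psi0 psiH.
have H0 : 0 < H by exact: harmonic_sum_gt0.
have r0 : 0 < Num.sqrt H by rewrite sqrtr_gt0.
have rr : Num.sqrt H * Num.sqrt H = H by rewrite -expr2 sqr_sqrtr ?ltW.
pose d := psi / Num.sqrt H.
have d0 : 0 <= d by rewrite divr_ge0 // ltW.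
have d1 : d <= 1 by rewrite ler_pdivrMr // mul1r.
have dH : d * H = psi * Num.sqrt H.
  by rewrite -[X in d * X]rr mulrA /d divfK ?gt_eqF.
have ddH : d ^+ 2 * H = psi ^+ 2.
  by rewrite expr2 -mulrA dH mulrCA /d divfK ?gt_eqF // expr2.
have bound x : 0 <= x -> x <= 2 -> (x - 1) ^+ 2 = d ^+ 2 ->
    expR (1 - Q x * H) <= 4 * expR (- (1 / 3) * psi ^+ 2).
  move=> x0 x2 xd; rewrite expRD ler_pM ?expR_ge0 ?expR1_le4 // ler_expR.
  have := ler_wpM2r (ltW H0) (Q_ge_quadratic x0 x2).
  rewrite xd mulrAC ddH; lra.
apply: le_trans (@perm_prob_le_add R _ _
  (fun s => (cycle_count I s)%:R <= (1 - d) * H)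
  (fun s => (1 + d) * H + 0 <= (cycle_count I s)%:R) _) _.
  move=> s; rewrite mulrBl mulrDl mul1r dH addr0 ler_normr; move: (_%:R) => c.
  case/orP=> h; apply/orP.
    by right; lra.
  by left; lra.
have lo := @lower_tail R n I (1 - d) I0 _ _.
have up := @upper_tail R n I 0 (1 + d) I0 _.
rewrite mul0r oppr0 expR0 mul1r in up.
have d'0 : 0 <= 1 - d by rewrite subr_ge0.
have d'1 : 1 - d <= 1 by rewrite gerBl.
have d''1 : 1 <= 1 + d by rewrite lerDl.
have b1 : expR (1 - Q (1 - d) * H) <= 4 * expR (- (1 / 3) * psi ^+ 2).
  by apply: bound; [lra|lra|ring].
have b2 : expR (1 - Q (1 + d) * H) <= 4 * expR (- (1 / 3) * psi ^+ 2).
  by apply: bound; [lra|lra|ring].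
apply: le_trans (lerD (lo d'0 d'1) (up d''1)) _.
have b3 : (1 + d) * expR (1 - Q (1 + d) * H)
    <= 2 * (4 * expR (- (1 / 3) * psi ^+ 2)).
  apply: ler_pM => //; rewrite ?expR_ge0 //; lra.
apply: le_trans (lerD b1 b3) _; lra.
Qed.

Theorem theorem1p7 (R : realType) (n : nat) (n_ge1 : (1 <= n)%N)
    (I : {set 'I_n.+1}) (I_sub : ord0 \notin I) (I_neq0 : I != set0) :
  let C := fun s : 'S_n => (cycle_count I s)%:R : R in
  let H := harmonic_sum R I in
  [/\ forall x : R, 0 <= x -> 0 <= Q x,
      forall lambda : R, 0 <= lambda -> lambda <= 1 ->
        perm_prob R (fun s => C s <= lambda * H)
          <= 2 * expR (1 - Q lambda * H),
      forall lambda : R, 1 <= lambda ->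
        perm_prob R (fun s => C s >= lambda * H + 1)
          <= 2 * expR (1 - Q lambda * H)
    & forall psi : R, 0 <= psi -> psi <= Num.sqrt H ->
        perm_prob R (fun s => `|C s - H| >= psi * Num.sqrt H)
          <= 20 * expR (- (1 / 3) * psi ^+ 2)].
Proof.
case: n n_ge1 I I_sub I_neq0 => // n _ I I0 In0 C H.
have weaken (k k' t : R) : k <= k' -> k * expR t <= k' * expR t.
  by move=> kk; rewrite ler_wpM2r ?expR_ge0.
split=> [x|x x0 x1|x x1|psi psi0 psiH].
- exact: Q_ge0.
- apply: le_trans (lower_tail I0 x0 x1) _.
  by rewrite -[leLHS]mul1r weaken // ler1n.
- have x0 := lt_le_trans ltr01 x1.
  apply: le_trans (upper_tail 1 I0 x1) _.
  rewrite mul1r expRN lnK ?posrE // mulKf ?gt_eqF //.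
  by rewrite -[leLHS]mul1r weaken // ler1n.
- apply: le_trans (central_tail I0 In0 psi0 psiH) _.
  by rewrite weaken // ler_nat.
Qed.
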